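(* Let $(X,d)$ be a compact metric space with no isolated point and let $(X,T,\lambda)$ be a $T$-space with $\lambda$ perfect. Suppose $f:X\to X$ is a $T$-pseudoequivariant onto map. Then $f$ is $T$-transitive if and only if there exists $x\in X$ such that $\{t f^n(x)\mid t\in T,\ n>0\}$ (with $n$ ranging over positive integers) is dense in $X$.
   Context: A generalized group is a semigroup $T$ such that (i) for each $t\in T$ there exists a unique $e(t)\in T$ with $t\cdot e(t)=e(t)\cdot t=t$; (ii) for each $t\in T$ there exists $s\in T$ with $s\cdot t=t\cdot s=e(t)$. The element $s$ in (ii) is unique and denoted $t^{-1}$. A topological generalized group is a Hausdorff topological space $T$ endowed with a generalized group structure such that $t\mapsto t^{-1}$ and $(s,t)\mapsto s\cdot t$ are continuous and $e(s\cdot t)=e(s)\cdot e(t)$ for all $s,t\in T$. Write $e(T)=\{e(t)\mid t\in T\}$. A generalized action of a topological generalized group $T$ on a topological space $X$ is a continuous map $\lambda:T\times X\to X$ such that (i) $\lambda(s,\lambda(t,x))=\lambda(s\cdot t,x)$ for all $s,t\in T$, $x\in X$; (ii) for each $x\in X$ there is an element of the form $e(t)\in T$ with $\lambda(e(t),x)=x$. One writes $tx$ for $\lambda(t,x)$ and $tU=\{tu\mid u\in U\}$. A $T$-space is a triple $(X,T,\lambda)$ where $X$ is a Hausdorff topological space, $T$ is a topological generalized group and $\lambda$ is a generalized action of $T$ on $X$. The stabilizer of $x$ is $T_x=\{t\in T\mid tx=x\}$ and the $T$-orbit of $x$ is $T(x)=\{tx\mid t\in T\}$. The generalized action $\lambda$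 is perfect if $e(T)\subseteq T_x$ for each $x\in X$. A continuous map $f:X\to Y$ between two $T$-spaces is $T$-pseudoequivariant if $f(T(x))=T(f(x))$ for each $x\in X$. A continuous map $f:X\to X$ on a $T$-space is $T$-transitive if for every pair of non-empty open subsets $U,V$ of $X$ there are a positive integer $n$ and $t\in T$ such that $tf^n(U)\cap V\neq\varnothing$. Here $f^n$ is the $n$-fold iterate of $f$. *)

(* Defs.v *)
From HB Require Import structures.
From mathcomp Require Import all_boot all_order all_algebra.
From mathcomp Require Import all_classical all_reals all_analysis.

Set Implicit Arguments.
Unset Strict Implicit.
Unset Printing Implicit Defensive.

Local Open Scope classical_set_scope.
Local Open Scope group_scope.

(* [gid t] is e(t); [gid_uniq] says that it is the only local identity of t.
   The inverse is an operation rather than an existence axiom: it is determined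
   by its two equations (lemma [ginv_uniq]). *)
HB.mixin Record Semigroup_isGeneralizedGroup G & Semigroup G := {
  gid : G -> G;
  mulg_gid : forall t : G, t * gid t = t;
  mul_gidg : forall t : G, gid t * t = t;
  gid_uniq : forall t u : G, t * u = t -> u * t = t -> u = gid t;
  ginv : G -> G;
  mul_ginvg : forall t : G, ginv t * t = gid t;
  mulg_ginv : forall t : G, t * ginv t = gid t
}.

#[short(type="genGroupType")]
HB.structure Definition GeneralizedGroup :=
  {G of Semigroup_isGeneralizedGroup G & Semigroup G}.

Lemma ginv_uniq (G : genGroupType) (t s : G) :
  s * t = gid t -> t * s = gid t -> s = ginv t.
Proof.
have eE (u v : G) : u * v = gid v -> v * u = gid v ->
    u * gid v = u /\ gid v * u = u.
  move=> uv vu.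
  have ee : gid v * gid v = gid v.
    by apply: gid_uniq; rewrite ?mulgA ?mulg_gid // -mulgA !mul_gidg.
  have -> : gid v = gid u.
    rewrite (gid_uniq _ _ ee ee); apply/esym/gid_uniq.
    - by rewrite -{1}vu -mulgA mulg_gid vu.
    - by rewrite -{1}uv mulgA mul_gidg uv.
  by rewrite mulg_gid mul_gidg.
move=> st ts.
rewrite -(eE _ _ st ts).1 -mulg_ginv mulgA st.
exact: (eE _ _ (mul_ginvg t) (mulg_ginv t)).2.
Qed.

HB.mixin Record isTopologicalGeneralizedGroup T
    & GeneralizedGroup T & Topological T := {
  tgg_hausdorff : hausdorff_space T;
  ginv_continuous : continuous (@ginv T);
  mulg_continuous : continuous (fun p : T * T => p.1 * p.2);
  gidM : forall t u : T, gid (t * u) = gid t * gid u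
}.

#[short(type="topGenGroupType")]
HB.structure Definition TopologicalGeneralizedGroup :=
  {T of isTopologicalGeneralizedGroup T & GeneralizedGroup T & Topological T}.

Record generalized_action (T : topGenGroupType) (X : topologicalType)
    (lam : T * X -> X) : Prop := GeneralizedAction {
  action_continuous : continuous lam;
  actionM : forall (s t : T) (x : X), lam (s, lam (t, x)) = lam (s * t, x);
  action_gid : forall x : X, exists t : T, lam (gid t, x) = x
}.

Record is_Tspace (X : topologicalType) (T : topGenGroupType)
    (lam : T * X -> X) : Prop := IsTspace {
  Tspace_hausdorff : hausdorff_space X;
  Tspace_action : generalized_action lam
}.

Definition idset (T : topGenGroupType) : set T := range (@gid T).
Arguments idset : clear implicits.

Definition stabilizer (T : topGenGroupType) (X : topologicalType)
    (lam : T * X -> X) (x : X) : set T := [set t | lam (t, x) = x].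

Definition Torbit (T : topGenGroupType) (X : topologicalType)
    (lam : T * X -> X) (x : X) : set X := [set lam (t, x) | t in [set: T]].

Definition translate (T : topGenGroupType) (X : topologicalType)
    (lam : T * X -> X) (t : T) (U : set X) : set X := [set lam (t, u) | u in U].

Definition perfect_action (T : topGenGroupType) (X : topologicalType)
    (lam : T * X -> X) : Prop :=
  forall x : X, idset T `<=` stabilizer lam x.

Record pseudoequivariant (T : topGenGroupType) (X Y : topologicalType)
    (lamX : T * X -> X) (lamY : T * Y -> Y) (f : X -> Y) : Prop :=
  Pseudoequivariant {
  pseudoequivariant_continuous : continuous f;
  pseudoequivariant_orbit :
    forall x : X, f @` Torbit lamX x = Torbit lamY (f x)
}.

Record Ttransitive (T : topGenGroupType) (X : topologicalType)
    (lam : T * X -> X) (f : X -> X) : Prop := TTransitive {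
  Ttransitive_continuous : continuous f;
  Ttransitive_meet : forall U V : set X,
    open U -> U !=set0 -> open V -> V !=set0 ->
    exists (n : nat) (t : T),
      (0 < n)%N /\ translate lam t (iter n f @` U) `&` V !=set0
}.

(* Main.v *)
Require Import Defs.
From HB Require Import structures.
From mathcomp Require Import all_boot all_order all_algebra.
From mathcomp Require Import all_classical all_reals all_analysis.

Local Open Scope classical_set_scope.

(** A point x works for the right-hand side exactly when it visits every
    non-empty open set V, that is, when it lies in the set of visitors
    W(V) = {x | t f^n(x) in V for some t and some n > 0}.

    For a transitive f, each W(V) is dense, and it is open since f and the
    translations are continuous. Compact metric spaces have a countable basis
    ([compact_metric_second_countable]) and satisfy Baire's theorem
    ([dense_bigcap_countable]), so some x lies in W(V) for all non-empty basic V.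

    Conversely, let O(x) = {t f^n(x) | n > 0} be dense. Some s f^m(x) lies in U,
    so what is needed is that V meets T(f^k(x)) for some k > m: the iterate f^n
    maps the whole orbit T(f^m(x)) onto the orbit T(f^(n+m)(x)), and translations
    are invertible within an orbit because the action is perfect. Now the tail
    of O(x) after time m is as dense as O(x) itself: it contains f^m(O(x)), and
    f^m is continuous and onto. *)

(** * Baire's theorem and second countability *)

(** The usual nested-neighbourhoods argument, with compactness instead of
    completeness: regularity gives non-empty open sets A_(n+1) whose closure is
    inside A_n and F_n, and a cluster point of the A_n lies in all the closures. *)
Lemma dense_bigcap_seq (X : topologicalType) (F : (set X)^nat) :
  compact [set: X] -> regular_space X ->
  (forall n, open (F n)) -> (forall n, dense (F n)) -> dense (\bigcap_n F n).
Proof.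
move=> cX rX oF dF D D0 oD.
have shrink (nU : nat * set X) : exists V : set X,
    open nU.2 -> nU.2 !=set0 ->
    [/\ open V, V !=set0 & closure V `<=` nU.2 `&` F nU.1].
  case: nU => n U /=.
  have [[oU U0]|nU] := pselect (open U /\ U !=set0); last first.
    by exists set0 => oU U0; case: nU.
  have [a UFa] := dF n U U0 oU.
  have := rX a (U `&` F n) (open_nbhs_nbhs (conj (openI oU (oF n)) UFa)).
  move=> [B nB BUF]; exists B° => _ _; split.
  - exact: open_interior.
  - by exists a.
  - by apply: subset_trans BUF; apply: closureS; exact: interior_subset.
have [g gP] := choice shrink.
pose fix A n := if n is m.+1 then g (m, A m) else D.
have AP n : open (A n) /\ A n !=set0.
  by elim: n => [//|n [oA A0]] /=; have [] := gP (n, A n) oA A0.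
have clA n : closure (A n.+1) `<=` A n `&` F n.
  by have [oA A0] := AP n; have [] := gP (n, A n) oA A0.
have decrA m n : (m <= n)%N -> A n `<=` A m.
  elim: n => [|n IH]; first by rewrite leqn0 => /eqP ->.
  rewrite leq_eqVlt => /predU1P[-> //|/IH]; apply: subset_trans => x.
  by move=> /subset_closure /clA[].
pose G := filter_from [set: nat] A.
have GF : ProperFilter G.
  apply: filter_from_proper; last by move=> n _; have [] := AP n.
  apply: filter_from_filter; first by exists 0%N.
  move=> i j _ _; exists (maxn i j) => // x Ax.
  by split; apply: decrA Ax; rewrite ?leq_maxl ?leq_maxr.
have [p [_ Gp]] := cX G GF filterT.
have clAp n : closure (A n) p.
  by move=> B pB; apply: Gp => //; exists n.
exists p; split; first by have [] := clA 0%N p (clAp 1%N).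
by move=> n _; have [] := clA n p (clAp n.+1).
Qed.

Lemma dense_bigcap_countable (X : topologicalType) (E : set (set X)) :
  compact [set: X] -> regular_space X -> countable E ->
  (forall U, E U -> open U) -> (forall U, E U -> dense U) ->
  dense (\bigcap_(U in E) U).
Proof.
move=> cX rX /pfcard_geP[->|[g]] oE dE.
  by rewrite bigcap_set0 => O O0 _; rewrite setIT.
have Eg n : E (g n) by exact: funS.
have dg : dense (\bigcap_n g n).
  by apply: dense_bigcap_seq => // n; [exact: oE|exact: dE].
move=> O O0 oO; have [x [Ox gx]] := dg O O0 oO.
exists x; split=> // U EU.
by have [n _ <-] : (g @` setT) U; [exact: surj|exact: gx].
Qed.

(** The point [x0] turns X into a pointed space with the same topology; balls of
    radius 1/(n+1) around finitely many centres then give a countable basis. *)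
Lemma compact_metric_second_countable (R : realType) (X : metricType R) (x0 : X) :
  compact [set: X] -> @second_countable X.
Proof.
pose X' : pseudoPMetricType R := HB.pack X (isPointed.Build X x0).
exact: (@compact_second_countable R X').
Qed.

(** * Iterates of pseudoequivariant maps under perfect actions *)

Lemma iter_continuous (X : topologicalType) (f : X -> X) n :
  continuous f -> continuous (iter n f).
Proof.
move=> cf; elim: n => [|n IH] x; first exact: cvg_id.
exact: (@continuous_comp _ _ _ (iter n f) f x (IH x) (cf _)).
Qed.

Lemma iter_onto (X : Type) (f : X -> X) n :
  range f = [set: X] -> range (iter n f) = [set: X].
Proof.
move=> fX; elim: n => [|n IH]; first by rewrite image_id.
apply/seteqP; split=> // y _.
have [z _ <-] : range f y by rewrite fX.
have [x _ <-] : range (iter n f) z by rewrite IH.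
by exists x.
Qed.

Lemma translate_continuous (T : topGenGroupType) (X : topologicalType)
    (lam : T * X -> X) t :
  generalized_action lam -> continuous (fun x => lam (t, x)).
Proof.
move=> act x; apply: (@continuous_comp _ _ _ (fun y => (t, y)) lam).
  by apply: cvg_pair; [exact: cvg_cst|exact: cvg_id].
exact: (action_continuous act).
Qed.

(** Every e(t) fixes every point, so the inverse of t undoes t. *)
Lemma perfect_translateK (T : topGenGroupType) (X : topologicalType)
    (lam : T * X -> X) t x :
  generalized_action lam -> perfect_action lam ->
  lam (ginv t, lam (t, x)) = x.
Proof.
by move=> act perf; rewrite (actionM act) mul_ginvg; apply: perf; exists t.
Qed.

Lemma iter_Torbit (T : topGenGroupType) (X : topologicalType)
    (lam : T * X -> X) (f : X -> X) n x :
  pseudoequivariant lam lam f ->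
  iter n f @` Torbit lam x = Torbit lam (iter n f x).
Proof.
move=> peq; elim: n => [|n IH]; first by rewrite image_id.
by rewrite iterS -(pseudoequivariant_orbit peq) -IH image_comp.
Qed.

(** * Visitors of an open set *)

Definition visitors {T : topGenGroupType} {X : topologicalType}
    (lam : T * X -> X) (f : X -> X) (V : set X) : set X :=
  [set x | exists n t, (0 < n)%N /\ V (lam (t, iter n f x))].

Lemma open_visitors (T : topGenGroupType) (X : topologicalType)
    (lam : T * X -> X) (f : X -> X) (V : set X) :
  generalized_action lam -> continuous f -> open V ->
  open (visitors lam f V).
Proof.
move=> act cf oV.
have -> : visitors lam f V = \bigcup_(p in [set p : nat * T | (0 < p.1)%N])
    (fun x => lam (p.2, iter p.1 f x)) @^-1` V.
  apply/seteqP; split=> [x [n [t [n0 Vx]]]|x [[n t] n0 Vx]]; first by exists (n, t).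
  by exists n, t.
apply: bigcup_open => -[n t] _ /=; apply: open_comp => // x _.
apply: (@continuous_comp _ _ _ (iter n f) (fun y => lam (t, y))).
  exact: iter_continuous.
exact: translate_continuous.
Qed.

Lemma dense_visitors (T : topGenGroupType) (X : topologicalType)
    (lam : T * X -> X) (f : X -> X) (V : set X) :
  Ttransitive lam f -> open V -> V !=set0 -> dense (visitors lam f V).
Proof.
move=> tr oV V0 U U0 oU.
have [n [t [n0 [_ [[_ [x Ux <-] <-] Vx]]]]] := Ttransitive_meet tr oU U0 oV V0.
by exists x; split => //; exists n, t.
Qed.

(** Applying f^m to a dense set {t f^n(x) | n > 0} leaves it dense, as f^m is
    continuous and onto, and puts it inside the part of times greater than m. *)
Lemma dense_orbit_tail (T : topGenGroupType) (X : topologicalType)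
    (lam : T * X -> X) (f : X -> X) (x : X) (m : nat) (V : set X) :
  pseudoequivariant lam lam f -> range f = [set: X] ->
  dense [set lam (t, iter n f x) | t in [set: T] & n in [set n | (0 < n)%N]] ->
  open V -> V !=set0 -> visitors lam f V (iter m f x).
Proof.
move=> peq fX dx oV [v Vv].
have [u _ uv] : range (iter m f) v by rewrite iter_onto.
have oU : open (iter m f @^-1` V).
  apply: open_comp => // y _; apply: iter_continuous.
  exact: (pseudoequivariant_continuous peq).
have [|y [Vy [t _ [n n0 yE]]]] := dx (iter m f @^-1` V) _ oU.
  by exists u; rewrite /= uv.
move: Vy; rewrite -{y}yE /=.
have : (iter m f @` Torbit lam (iter n f x)) (iter m f (lam (t, iter n f x))).
  by exists (lam (t, iter n f x)) => //; exists t.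
rewrite iter_Torbit // => -[s _ /= <-]; rewrite -iterD addnC iterD => Vs.
by exists n, s.
Qed.

Theorem theorem3p5 (R : realType) (X : metricType R) (T : topGenGroupType)
    (lam : T * X -> X) (f : X -> X)
    (X_nonempty : [set: X] !=set0)
    (X_compact : compact [set: X])
    (X_no_isolated : isolated [set: X] = set0)
    (X_Tspace : is_Tspace lam)
    (lam_perfect : perfect_action lam)
    (f_pseudoequivariant : pseudoequivariant lam lam f)
    (f_onto : range f = [set: X]) :
  Ttransitive lam f <->
  exists x : X,
    dense [set lam (t, iter n f x) | t in [set: T] & n in [set n | (0 < n)%N]].
Proof.
have act := Tspace_action X_Tspace.
have cf := pseudoequivariant_continuous f_pseudoequivariant.
split=> [tr|[x dx]].
- have [x0 _] := X_nonempty.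
  have [B cB [oB basisB]] := compact_metric_second_countable R X x0 X_compact.
  pose E := visitors lam f @` (B `&` [set V | V !=set0]).
  have dE : dense (\bigcap_(W in E) W).
    apply: dense_bigcap_countable => //.
    + exact: uniform_regular.
    + apply: (card_le_trans (card_image_le _ _)).
      by apply: sub_countable cB; apply: subset_card_le => V [].
    + by move=> _ [V [BV _] <-]; apply: open_visitors => //; exact: oB.
    + by move=> _ [V [BV V0] <-]; apply: dense_visitors => //; exact: oB.
  have [x [_ Ex]] := dE setT X_nonempty openT.
  exists x => W [w Ww] oW.
  have [V [BV Vw] VW] := basisB w W (open_nbhs_nbhs (conj oW Ww)).
  have [n [t [n0 Vt]]] : visitors lam f V x.
    by apply: Ex; exists V => //; split => //; exists w.
  by exists (lam (t, iter n f x)); split; [exact: VW|exists t => //; exists n].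
- split=> // U V oU U0 oV V0.
  have [y [Uy [s _ [m m0 yE]]]] := dx U U0 oU.
  move: Uy; rewrite -{y}yE => Us.
  have [n [t [n0 Vt]]] : visitors lam f V (iter m f x).
    exact: dense_orbit_tail.
  have : (iter n f @` Torbit lam (iter m f x)) (iter n f (lam (s, iter m f x))).
    by exists (lam (s, iter m f x)) => //; exists s.
  rewrite iter_Torbit // => -[r _ /= rE].
  (* The iterate of the point of U is r f^n(f^m(x)); undoing r by its inverse
     and then acting by t moves it into V. *)
  exists n, (t * ginv r)%g; split => //; exists (lam (t, iter n f (iter m f x))).
  split => //; exists (iter n f (lam (s, iter m f x))).
    by exists (lam (s, iter m f x)).
  by rewrite -rE -(actionM act) perfect_translateK.
Qed.
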